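(* Let $B=\{\underline{\mathbf{x}}^{\beta_1},\ldots,\underline{\mathbf{x}}^{\beta_r}\}$ and $B'=\{\underline{\mathbf{x}}^{\beta'_1},\ldots,\underline{\mathbf{x}}^{\beta'_r}\}$ be two sets of $r$ monomials in $R_{\delta_1,\ldots,\delta_k}$, each connected to $1$. Let $\Lambda$ be a linear form in $(\langle B'^{+}\cdot B^{+}\rangle_{\delta_1,\ldots,\delta_k})^{*}$, and let $\Lambda(\mathbf{h})$ be the linear form on $\langle B'^{+}\cdot B^{+}\rangle$ defined on the monomials $\underline{\mathbf{x}}^{\alpha}\in B'^{+}\cdot B^{+}$ by $\Lambda(\mathbf{h})(\underline{\mathbf{x}}^{\alpha})=\Lambda(\underline{\mathbf{x}}^{\alpha})$ if $\underline{\mathbf{x}}^{\alpha}\in R_{\delta_1,\ldots,\delta_k}$, and $\Lambda(\mathbf{h})(\underline{\mathbf{x}}^{\alpha})=h_{\alpha}\in\mathbb{K}$ otherwise. Then $\Lambda(\mathbf{h})$ admits an extension $\tilde\Lambda\in R^{*}$ such that $H_{\tilde\Lambda}$ is of rank $r$, with $B$ and $B'$ each a basis of $\mathcal{A}_{\tilde\Lambda}$, if and only if all $(r+1)\times(r+1)$-minors of $\mathcal{H}^{B'^{+},B^{+}}_{\Lambda(\mathbf{h})}$ vanish and $\det\big(\mathcal{H}^{B',B}_{\Lambda(\mathbf{h})}\big)\neq 0$.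
   Context: $\mathbb{K}$ is an algebraically closed field of characteristic $0$. Fix $k$, $n_1,\ldots,n_k$ and $\delta_1,\ldots,\delta_k\in\mathbb{N}$. $R=\mathbb{K}[\underline{\mathbf{x}}_1,\ldots,\underline{\mathbf{x}}_k]$ is the polynomial ring in all the variables $x_{i,l}$, $1\le l\le k$, $1\le i\le n_l$, where $\underline{\mathbf{x}}_l=(x_{1,l},\ldots,x_{n_l,l})$. For $\alpha=(\alpha_1,\ldots,\alpha_k)\in\mathbb{N}^{n_1}\times\cdots\times\mathbb{N}^{n_k}$, $\underline{\mathbf{x}}^{\alpha}=\prod_{l=1}^{k}\prod_{i=1}^{n_l}x_{i,l}^{\alpha_{i,l}}$ and $|\alpha_l|=\sum_i\alpha_{i,l}$. $R_{\delta_1,\ldots,\delta_k}$ is the subspace of $R$ spanned by the monomials $\underline{\mathbf{x}}^{\alpha}$ with $|\alpha_l|\le\delta_l$ for all $l$. $\langle F\rangle$ denotes the $\mathbb{K}$-linear span of $F$, and $E^{*}$ the dual space of a $\mathbb{K}$-vector space $E$. A set $B$ of monomials is connected to $1$ if for every $m\in B$ either $m=1$ or $m=x_{i,l}\,m'$ for some variable $x_{i,l}$ and some $m'\in B$. $B^{+}=B\cup\bigcup_{i,l}x_{i,l}B$ (union over all variables of $R$), and similarly for $B'^{+}$. $B'^{+}\cdot B^{+}$ is the set of products $b'b$ with $b'\in B'^{+}$, $b\in B^{+}$, and $\langle B'^{+}\cdot B^{+}\rangle_{\delta_1,\ldots,\delta_k}=\langle B'^{+}\cdot B^{+}\rangle\cap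 R_{\delta_1,\ldots,\delta_k}$. For $\tilde\Lambda\in R^{*}$ and $p\in R$, $p\star\tilde\Lambda\in R^{*}$ is $q\mapsto\tilde\Lambda(pq)$. The Hankel operator is $H_{\tilde\Lambda}:R\to R^{*}$, $p\mapsto p\star\tilde\Lambda$; its kernel $I_{\tilde\Lambda}$ is an ideal of $R$ and $\mathcal{A}_{\tilde\Lambda}=R/I_{\tilde\Lambda}$. ''$B$ is a basis of $\mathcal{A}_{\tilde\Lambda}$'' means that the classes of the elements of $B$ form a $\mathbb{K}$-basis of $\mathcal{A}_{\tilde\Lambda}$. An extension of $\Lambda(\mathbf{h})$ is an element of $R^{*}$ whose restriction to $\langle B'^{+}\cdot B^{+}\rangle$ is $\Lambda(\mathbf{h})$. For sets of monomials $C'\subseteq B'^{+}$ and $C\subseteq B^{+}$, $\mathcal{H}^{C',C}_{\Lambda(\mathbf{h})}=(\Lambda(\mathbf{h})(c'c))_{c'\in C',\,c\in C}$ (rows indexed by $C'$, columns by $C$). *)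

(* Defs.v *)
From HB Require Import structures.
From mathcomp Require Import all_boot all_order all_algebra ring_quotient.
From mathcomp Require Import boolp classical_sets functions.
From mathcomp Require Import mpoly.

Set Implicit Arguments.
Unset Strict Implicit.
Unset Printing Implicit Defensive.

Import GRing.Theory.
Local Open Scope ring_scope.
Local Open Scope classical_set_scope.

Section LinearAlgebra.
Variables (K : fieldType) (V : lmodType K).

Definition lspan (F : set V) : set V :=
  [set v | exists n (u : 'I_n -> V) (c : 'I_n -> K),
     (forall i, F (u i)) /\ v = \sum_i c i *: u i].

Definition lfree n (u : 'I_n -> V) : Prop :=
  forall c : 'I_n -> K, \sum_i c i *: u i = 0 -> forall i, c i = 0.

Definition lbasis n (u : 'I_n -> V) (E : set V) : Prop :=
  lfree u /\ lspan (range u) = E.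

(* A linear form on the subspace E is a total function on V that is linear on
   E; its values outside E carry no meaning. *)
Definition linear_form_on (E : set V) (f : V -> K) : Prop :=
  forall (a : K) (u v : V), E u -> E v -> f (a *: u + v) = a * f u + f v.

End LinearAlgebra.

Definition has_rank (K : fieldType) (U V : lmodType K) (f : U -> V) (r : nat) :
    Prop :=
  exists u : 'I_r -> V, lbasis u (range f).

(* A monomial is represented by its exponent vector in 'X_{1..N}: the monomial
   1 is 0%MM, the variable of index i is U_(i)%MM, and products of monomials
   are sums of exponents. *)
Section Monomials.
Variables (K : fieldType) (N : nat).
Implicit Types B C : seq 'X_{1..N}.

Definition connected_to_1 B : Prop :=
  forall m, m \in B ->
    m = 0%MM \/ exists i : 'I_N, exists2 m', m' \in B & m = (U_(i) + m')%MM.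

Definition mplus B : seq 'X_{1..N} :=
  undup (B ++ [seq (U_(i) + b)%MM | i <- enum 'I_N, b <- B]).

Definition mprod C B : seq 'X_{1..N} := [seq (c + b)%MM | c <- C, b <- B].

Definition mspan (P : set 'X_{1..N}) : set {mpoly K[N]} :=
  lspan [set 'X_[m] | m in P].

Definition hankel_mx (L : {mpoly K[N]} -> K) (p q : nat)
    (C' : p.-tuple 'X_{1..N}) (C : q.-tuple 'X_{1..N}) : 'M[K]_(p, q) :=
  \matrix_(i, j) L ('X_[tnth C' i] * 'X_[tnth C j]).

End Monomials.

Arguments mspan K {N} P.

Section HankelOperator.
Variables (K : fieldType) (N : nat).
Local Notation R := {mpoly K[N]}.
Implicit Type L : {scalar R}.

Definition star (p : R) L : R -> K := fun q => L (p * q).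

Fact star_is_scalar p L : scalar (star p L).
Proof. by move=> a u v; rewrite /star mulrDr -scalerAr linearP. Qed.

HB.instance Definition _ p L :=
  GRing.isLinear.Build K R K *%R (star p L) (star_is_scalar p L).

Definition hankel_op L (p : R) : {scalar R} := star p L.

(* The dual of R seen in the space of all functions R -> K with the pointwise
   operations, which is where rank and kernel are computed. *)
Definition dual_fun (f : {scalar R}) : R -> K^o := f.

Definition hankel_ker L : {pred R} :=
  fun p => `[< dual_fun (hankel_op L p) = 0 >].

Fact hankel_ker_submod L : submod_closed (hankel_ker L).
Proof.
split=> [|a p q /asboolP hp /asboolP hq]; apply/asboolP; apply/funext => x.
  by rewrite /dual_fun /= /star mul0r linear0.
have := congr1 (fun f => f x) hp; have := congr1 (fun f => f x) hq.
rewrite /dual_fun /= /star => hqx hpx.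
by rewrite mulrDl -scalerAl linearP hpx hqx mulr0 addr0.
Qed.

HB.instance Definition _ L :=
  GRing.isSubmodClosed.Build K R (hankel_ker L) (hankel_ker_submod L).

(* The library quotient is only a Z-module; it inherits the scalar
   multiplication because hankel_ker L is a subspace. *)
Definition hankel_quot L : Type := {ideal_quot (hankel_ker L)}.

Section QuotientModule.
Variable L : {scalar R}.
Local Notation A := (hankel_quot L).

HB.instance Definition _ := GRing.Zmodule.on A.

Definition hankel_cls (p : R) : A := \pi_({ideal_quot (hankel_ker L)})%qT p.

Lemma hankel_cls_eq p q :
  hankel_cls p = hankel_cls q <-> p - q \in hankel_ker L.
Proof. by rewrite Quotient.idealrBE; split=> [h|/eqP h]; [apply/eqP|]; exact: h. Qed.

Lemma hankel_clsD p q : hankel_cls (p + q) = hankel_cls p + hankel_cls q.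
Proof. exact: (raddfD \pi_({ideal_quot (hankel_ker L)})%qT). Qed.

Definition hankel_rep (x : A) : R := repr (x : {ideal_quot (hankel_ker L)}).

Lemma hankel_repK x : hankel_cls (hankel_rep x) = x.
Proof. exact: reprK. Qed.

Definition quot_scale (a : K) (x : A) : A := hankel_cls (a *: hankel_rep x).

Lemma quot_scale_cls a p : quot_scale a (hankel_cls p) = hankel_cls (a *: p).
Proof.
apply/hankel_cls_eq; rewrite -scalerBr; apply: rpredZ.
by apply/hankel_cls_eq; rewrite hankel_repK.
Qed.

Fact quot_scaleA a b x : quot_scale a (quot_scale b x) = quot_scale (a * b) x.
Proof. by rewrite -(hankel_repK x) !quot_scale_cls scalerA. Qed.

Fact quot_scale1 : left_id 1 quot_scale.
Proof. by move=> x; rewrite -(hankel_repK x) quot_scale_cls scale1r. Qed.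

Fact quot_scaleDr : right_distributive quot_scale +%R.
Proof.
move=> a x y; rewrite -(hankel_repK x) -(hankel_repK y).
by rewrite -hankel_clsD !quot_scale_cls scalerDr hankel_clsD.
Qed.

Fact quot_scaleDl x : {morph quot_scale^~ x : a b / a + b}.
Proof.
by move=> a b; rewrite -(hankel_repK x) !quot_scale_cls scalerDl hankel_clsD.
Qed.

HB.instance Definition _ := GRing.Zmodule_isLmodule.Build K A
  quot_scaleA quot_scale1 quot_scaleDr quot_scaleDl.

End QuotientModule.

End HankelOperator.

(* The variable x_{i,l} is the variable of index tagnat.Rank l i among the
   \sum_l n l variables of R, so the following is |alpha_l|. *)
Definition block_deg (k : nat) (n : 'I_k -> nat)
    (m : 'X_{1..\sum_(l < k) n l}) (l : 'I_k) : nat :=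
  \sum_(i < n l) m (tagnat.Rank l i).

Definition Rdelta (K : fieldType) (k : nat) (n delta : 'I_k -> nat) :
    set {mpoly K[\sum_(l < k) n l]} :=
  mspan K [set m | forall l, (block_deg m l <= delta l)%N].

Arguments Rdelta K {k} n delta.

(* Main.v *)
Require Import Defs.
From HB Require Import structures.
From mathcomp Require Import all_boot all_order all_algebra.
From mathcomp Require Import boolp classical_sets functions.
From mathcomp Require Import ssrcomplements mpoly.

Set Implicit Arguments.
Unset Strict Implicit.
Unset Printing Implicit Defensive.

Import GRing.Theory.
Local Open Scope ring_scope.
Local Open Scope classical_set_scope.

(** Write H for the Hankel matrix of the form, with rows in B'^+ and columns in
    B^+, and M for its submatrix with rows B' and columns B.

    If an extension exists for which B and B' are bases of the quotient algebra
    A, then p, q |-> Lambda (p q) is a perfect pairing on A, whose matrix in the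
    bases B' and B is M: hence det M <> 0 ([hankel_mx_det_neq0]). Every column
    of H is a combination of the r columns indexed by B, so the (r+1)-minors
    vanish ([hankel_minor_eq0]).

    Conversely, if det M <> 0 and the (r+1)-minors vanish, then the Schur
    complement of M in each bordered minor is zero ([bordered_minor_eq0]): the
    entry of H at (s, t) is the product (row of s) M^-1 (column of t). In A the
    multiplication by x_i has to be given, in the basis B, by the matrix
    X_i = M^-1 H_i, where H_i is the Hankel matrix of B' and x_i B. By the
    product formula M X_i X_j = H_i M^-1 H_j is the Hankel matrix of x_i B' and
    x_j B, which is symmetric in i and j; so the X_i commute and polynomials can
    be evaluated at them. The extension is
      p |-> e' M p(X) e,
    where e and e' are the coordinates of the monomial 1 in B and B'. Because B
    and B' are connected to 1, X^b e is the basis vector of b for b in B, and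
    e' M X^b' is the row of b' in M for b' in B'. From these two facts follow
    the agreement with the given form on products of B'^+ and B^+, and that p is
    in the kernel of the Hankel operator exactly when p(X) e = 0, equivalently
    when e' M p(X) = 0, so that B and B' are bases of the quotient
    ([flat_extension]). *)

(** * Linear spans and linear forms on them *)

Section LinearAlgebra.
Variables (K : fieldType) (V : lmodType K).

Lemma lspan_rangeP n (u : 'I_n -> V) (v : V) :
  lspan (range u) v <-> exists c : 'I_n -> K, v = \sum_i c i *: u i.
Proof.
split=> [[m [w [d [wu ->]]]]|[c ->]]; last first.
  by exists n, u, c; split=> // i; exists i.
have /choice[s sE] : forall j : 'I_m, exists i, u i = w j.
  by move=> j; have [i _ <-] := wu j; exists i.
exists (fun i => \sum_(j | s j == i) d j).
rewrite (partition_big s xpredT) //=; apply: eq_bigr => i _.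
by rewrite scaler_suml; apply: eq_bigr => j /eqP <-; rewrite sE.
Qed.

Lemma linear_form_on_sum (F : set V) (f : V -> K) n (u : 'I_n -> V)
    (c : 'I_n -> K) :
  linear_form_on (lspan F) f -> (forall i, F (u i)) ->
  f (\sum_i c i *: u i) = \sum_i c i * f (u i).
Proof.
move=> flin; have span0 : lspan F 0.
  by exists 0%N, (fun _ => 0), (fun _ => 0); split=> [[]|]; rewrite ?big_ord0.
have f0 : f 0 = 0.
  have := flin 1 0 0 span0 span0; rewrite scaler0 addr0 mul1r => /eqP.
  by rewrite -subr_eq subrr => /eqP.
elim: n u c => [|n IHn] u c uF; first by rewrite !big_ord0.
rewrite !big_ord_recl flin ?IHn //; last first.
  by exists n, (fun i => u (lift ord0 i)), (fun i => c (lift ord0 i)).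
by exists 1%N, (fun _ => u ord0), (fun _ => 1); split=> //; rewrite big_ord1 scale1r.
Qed.

Lemma eq_linear_form_on (F : set V) (f g : V -> K) :
  linear_form_on (lspan F) f -> linear_form_on (lspan F) g ->
  (forall v, F v -> f v = g v) -> forall v, lspan F v -> f v = g v.
Proof.
move=> flin glin fg _ [n [u [c [uF ->]]]].
rewrite (linear_form_on_sum _ flin) // (linear_form_on_sum _ glin) //.
by apply: eq_bigr => i _; rewrite fg.
Qed.

End LinearAlgebra.

Lemma mspan_mpolyX (K : fieldType) N (P : set 'X_{1..N}) m :
  P m -> mspan K P 'X_[m].
Proof.
move=> Pm; exists 1%N, (fun=> 'X_[m]), (fun=> 1); split=> [_|].
  by exists m.
by rewrite big_ord1 scale1r.
Qed.

(** * Bases of the quotient by the kernel of a Hankel operator *)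

Section HankelQuotient.
Variables (K : fieldType) (N : nat).
Local Notation R := {mpoly K[N]}.

Variable L : {scalar R}.

Lemma hankel_suml r (w : 'I_r -> R) (c : 'I_r -> K) (q : R) :
  L ((\sum_j c j *: w j) * q) = \sum_j c j * L (w j * q).
Proof.
rewrite mulr_suml linear_sum; apply: eq_bigr => j _.
by rewrite -scalerAl linearZ.
Qed.

Lemma hankel_kerP (p : R) :
  reflect (forall q : R, L (p * q) = 0) (p \in hankel_ker L).
Proof.
apply: (iffP (asboolP _)) => [h q|h].
  by have := congr1 (fun f : R -> K^o => f q) h.
by apply/funext => q; exact: h.
Qed.

Lemma hankel_cls_sum r (w : 'I_r -> R) (c : 'I_r -> K) :
  hankel_cls L (\sum_j c j *: w j) = \sum_j c j *: hankel_cls L (w j).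
Proof.
have cls0 : hankel_cls L 0 = 0.
  by apply: (addIr (hankel_cls L 0)); rewrite -hankel_clsD !add0r.
rewrite (big_morph _ (@hankel_clsD _ _ L) cls0).
by apply: eq_bigr => j _; rewrite -quot_scale_cls.
Qed.

(** Replaces classes in the quotient by polynomials modulo the kernel, so that
    all later arguments take place in the polynomial ring. *)
Lemma hankel_basisP r (w : 'I_r -> R) :
  lbasis (fun j => hankel_cls L (w j)) setT <->
  (forall c : 'I_r -> K,
     \sum_j c j *: w j \in hankel_ker L -> forall j, c j = 0) /\
  (forall p : R, exists c : 'I_r -> K, p - \sum_j c j *: w j \in hankel_ker L).
Proof.
have cls0 p : hankel_cls L p = 0 <-> p \in hankel_ker L.
  have -> : 0 = hankel_cls L 0.
    by apply: (addIr (hankel_cls L 0)); rewrite -hankel_clsD !add0r.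
  by rewrite hankel_cls_eq subr0.
split=> [[wfree wspan]|[wfree wspan]].
  split=> [c /cls0|p]; first by rewrite hankel_cls_sum => /wfree.
  have : lspan (range (fun j => hankel_cls L (w j))) (hankel_cls L p).
    by rewrite wspan.
  by move=> /lspan_rangeP[c]; rewrite -hankel_cls_sum => /hankel_cls_eq; exists c.
split=> [c|]; first by rewrite -hankel_cls_sum => /cls0; exact: wfree.
apply/seteqP; split=> // x _; apply/lspan_rangeP.
have [c wc] := wspan (hankel_rep x); exists c.
by rewrite -hankel_cls_sum -[LHS]hankel_repK; apply/hankel_cls_eq.
Qed.

(** The range of the Hankel operator is isomorphic to the quotient by its
    kernel, so a basis of the quotient is carried to a basis of the range. *)
Lemma hankel_basis_rank r (w : 'I_r -> R) :
  lbasis (fun j => hankel_cls L (w j)) setT ->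
  has_rank (fun p => dual_fun (hankel_op L p)) r.
Proof.
move=> /hankel_basisP[wfree wspan].
pose H p := dual_fun (hankel_op L p).
have H_sum (c : 'I_r -> K) : \sum_j c j *: H (w j) = H (\sum_j c j *: w j).
  by apply/funext => q; rewrite fct_sumE /H /dual_fun /= /star hankel_suml.
have HE p q : p - q \in hankel_ker L -> H p = H q.
  move=> /hankel_kerP pq; apply/funext => t; apply/eqP; rewrite -subr_eq0.
  by rewrite /H /dual_fun /= /star -linearB -mulrBl pq.
exists (fun j => H (w j)); split=> [c|].
  by rewrite H_sum => h; apply: wfree; apply/asboolP.
apply/seteqP; split=> [f /lspan_rangeP[c ->]|_ [p _ <-]].
  by exists (\sum_j c j *: w j); rewrite -?H_sum.
have [c pc] := wspan p; apply/lspan_rangeP; exists c.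
by rewrite H_sum; apply: HE.
Qed.

(** Such a T induces an injection of the quotient into K^r, which is onto because
    the canonical basis is attained. *)
Lemma hankel_basis_coord r (w : 'I_r -> R) (T : {linear R -> 'cV[K]_r}) :
  (forall p : R, p \in hankel_ker L <-> T p = 0) ->
  (forall j, T (w j) = delta_mx j 0) ->
  lbasis (fun j => hankel_cls L (w j)) setT.
Proof.
move=> kerT Tw.
have T_sum (c : 'I_r -> K) : T (\sum_j c j *: w j) = \col_j c j.
  rewrite linear_sum /=; apply/colP => i; rewrite summxE mxE (bigD1 i) //=.
  rewrite linearZ /= Tw !mxE !eqxx mulr1 big1 ?addr0 // => j ji.
  by rewrite linearZ /= Tw !mxE eq_sym (negPf ji) mulr0.
apply/hankel_basisP; split=> [c /kerT|p].
  by rewrite T_sum => /colP c0 j; have := c0 j; rewrite !mxE.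
exists (fun j => T p j 0); apply/kerT; rewrite linearB /= T_sum.
by apply/colP => j; rewrite !mxE subrr.
Qed.

End HankelQuotient.

(** * From a linear form with bases B and B' to the minors *)
Section ExtensionImpliesMinors.
Variables (K : fieldType) (N : nat) (L : {scalar {mpoly K[N]}}) (r : nat).
Variable B : r.-tuple 'X_{1..N}.
Hypothesis B_basis : lbasis (fun j => hankel_cls L 'X_[tnth B j]) setT.

(** A row vector v in the left kernel gives a combination of B' on which L
    vanishes after multiplication by each element of B. As B spans R modulo the
    kernel of the Hankel operator, the combination lies in that kernel, and it
    is zero because B' is free. *)
Lemma hankel_mx_det_neq0 (B' : r.-tuple 'X_{1..N}) :
  lbasis (fun j => hankel_cls L 'X_[tnth B' j]) setT ->
  \det (hankel_mx L B' B) != 0.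
Proof.
move=> /hankel_basisP[B'free _]; have /hankel_basisP[_ Bspan] := B_basis.
apply/det0P => -[v v_neq0 vM]; case/eqP: v_neq0; apply/rowP => i.
rewrite [RHS]mxE; apply: (B'free (v 0)); apply/hankel_kerP => q.
have [c /hankel_kerP qc] := Bspan q.
rewrite mulrC -[q](subrK (\sum_j c j *: 'X_[tnth B j])) mulrDl linearD /= qc.
rewrite add0r hankel_suml big1 // => j _; rewrite [X in L X]mulrC hankel_suml.
have := congr1 (fun A : 'rV_r => A 0 j) vM; rewrite !mxE => vMj.
rewrite (_ : \sum_a _ = 0) ?mulr0 // -[RHS]vMj; apply: eq_bigr => a _.
by rewrite mxE.
Qed.

(** Modulo the kernel each column monomial is a combination of the r elements
    of B, so any Hankel matrix factors through K^r. *)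
Lemma hankel_minor_eq0 p q (C' : p.-tuple 'X_{1..N}) (C : q.-tuple 'X_{1..N})
    (f : 'I_r.+1 -> 'I_p) (g : 'I_r.+1 -> 'I_q) :
  \det (mxsub f g (hankel_mx L C' C)) = 0.
Proof.
have /hankel_basisP[_ Bspan] := B_basis.
have /choice[c cP] := fun j => Bspan 'X_[tnth C (g j)].
pose P := \matrix_(i, k) L ('X_[tnth C' (f i)] * 'X_[tnth B k]).
pose Q := \matrix_(k, j) c j k.
have -> : mxsub f g (hankel_mx L C' C) = P *m Q.
  apply/matrixP => i j; rewrite !mxE mulrC.
  rewrite -['X_[tnth C (g j)]](subrK (\sum_k c j k *: 'X_[tnth B k])) mulrDl.
  rewrite linearD /= (hankel_kerP _ _ (cP j)) add0r hankel_suml.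
  by apply: eq_bigr => k _; rewrite !mxE mulrC ['X_[_] * _]mulrC.
apply/eqP; apply: contraTT (mulmx_max_rank P Q).
by rewrite -unitfE -unitmxE => /mxrank_unit ->; rewrite -ltnNge.
Qed.

End ExtensionImpliesMinors.

(** * Vanishing of bordered minors *)

(** The Schur complement formula. The border is placed first because 1 + r
    reduces to r.+1, the size of the minors below, while r + 1 does not. *)
Lemma bordered_det (K : fieldType) r (M : 'M[K]_r) (w : 'M[K]_1)
    (v : 'rV[K]_r) (u : 'cV[K]_r) :
  M \in unitmx ->
  \det (block_mx w v u M : 'M_(1 + r)) = (w - v *m invmx M *m u) 0 0 * \det M.
Proof.
move=> Mu; rewrite -[LHS]mul1r.
have <- : \det (block_mx 1%:M (- (v *m invmx M)) 0 1%:M : 'M_(1 + r)) = 1.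
  by rewrite det_ublock !det1 mulr1.
rewrite -det_mulmx mulmx_block !mul1mx !mul0mx !add0r !mulNmx mulmxKV // subrr.
by rewrite det_lblock det_mx11.
Qed.

(** Bordering an invertible r x r submatrix by row s and column t gives an
    (r+1)-minor; as it vanishes, so does the Schur complement, which expresses
    the entry (s, t) through the entries of the r chosen rows and columns. *)
Lemma bordered_minor_eq0 (K : fieldType) r p q (H : 'M[K]_(p, q))
    (f : 'I_r -> 'I_p) (g : 'I_r -> 'I_q) s t :
  (forall (f : 'I_r.+1 -> 'I_p) (g : 'I_r.+1 -> 'I_q),
     injective f -> injective g -> \det (mxsub f g H) = 0) ->
  mxsub f g H \in unitmx ->
  H s t = (rowsub (fun _ : 'I_1 => s) (colsub g H) *m invmx (mxsub f g H)
           *m colsub (fun _ : 'I_1 => t) (rowsub f H)) 0 0.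
Proof.
move=> minors Mu.
(* If s or t is among the chosen indices, the bordered matrix has a repeated
   row or column, and its determinant still vanishes. *)
have minors_any (f1 : 'I_r.+1 -> 'I_p) (g1 : 'I_r.+1 -> 'I_q) :
    \det (mxsub f1 g1 H) = 0.
  have [/injectiveP f1i|/injectivePn[i [j ij fij]]] := boolP (injectiveb f1).
    have [/injectiveP|/injectivePn[i [j ij gij]]] := boolP (injectiveb g1).
      exact: minors.
    rewrite -det_tr; apply: (determinant_alternate ij) => k.
    by rewrite !mxE gij.
  by apply: (determinant_alternate ij) => k; rewrite !mxE fij.
pose ext n (k : 'I_n) (h : 'I_r -> 'I_n) (i : 'I_(1 + r)) :=
  match fintype.split i with inl _ => k | inr j => h j end.
have := minors_any (ext p s f) (ext q t g).
have -> : mxsub (ext p s f) (ext q t g) H =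
    block_mx (H s t)%:M (rowsub (fun _ : 'I_1 => s) (colsub g H))
      (colsub (fun _ : 'I_1 => t) (rowsub f H)) (mxsub f g H) :> 'M_(1 + r).
  apply/matrixP => i j; rewrite !mxE /ext.
  case: (fintype.split i) => a; rewrite !mxE;
    by case: (fintype.split j) => b; rewrite !mxE ?ord1.
rewrite bordered_det // => /eqP; rewrite mulf_eq0 -[\det _ == 0]negbK.
rewrite -unitfE -unitmxE Mu orbF [X in X == _]mxE [X in X + _]mxE eqxx mulr1n.
by rewrite [X in _ + X]mxE subr_eq0 => /eqP.
Qed.

(** * Evaluation of polynomials at commuting matrices *)
Section CommutingMatrices.
Variables (K : fieldType) (N r : nat) (X : 'I_N -> 'M[K]_r).
Hypothesis X_comm : forall i j, X i *m X j = X j *m X i.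
Local Notation R := {mpoly K[N]}.

(** The product is taken in the ring structure of 'M_r that allows r = 0, so
    that the empty bases need no separate treatment. *)
Definition mx_monom (m : 'X_{1..N}) : 'M[K]_r := \prod_i X i ^+ m i.

Definition mx_eval (p : R) : 'M[K]_r :=
  \sum_(m <- msupp p) p@_m *: mx_monom m.

Lemma mx_monom0 : mx_monom 0%MM = 1%:M.
Proof. by rewrite /mx_monom big1 // => i _; rewrite mnm0E expr0. Qed.

Lemma mx_monomD m1 m2 : mx_monom (m1 + m2)%MM = mx_monom m1 *m mx_monom m2.
Proof.
rewrite /mx_monom [RHS](_ : _ = (\prod_i X i ^+ m1 i) * \prod_i X i ^+ m2 i) //.
rewrite -prodrM_comm; last first.
  by move=> i j _ _; apply/commrX/commr_sym/commrX; apply: X_comm.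
by apply: eq_bigr => i _; rewrite mnmDE exprD.
Qed.

Lemma mx_monomU i : mx_monom U_(i)%MM = X i.
Proof.
rewrite /mx_monom (eq_bigr (fun j => if j == i then X j else 1)) => [|j _].
  by rewrite -big_mkcond big_pred1_eq.
by rewrite mnm1E eq_sym; case: (j == i).
Qed.

Lemma mx_eval_is_linear : linear mx_eval.
Proof.
have evalE k p : (msize p <= k)%N ->
    mx_eval p = \sum_(m : 'X_{1..N < k}) p@_m *: mx_monom m.
  move=> pk; pose I : subFinType _ := 'X_{1..N < k}.
  rewrite /mx_eval (big_mksub I) ?msupp_uniq //=; last first.
    by move=> m /msize_mdeg_lt/leq_trans; apply.
  by rewrite big_rmcond //= => m /memN_msupp_eq0 ->; rewrite scale0r.
move=> a p q; pose k := maxn (msize (a *: p + q)) (maxn (msize p) (msize q)).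
rewrite !(evalE k) ?leq_max ?leqnn ?orbT // scaler_sumr -big_split /=.
by apply: eq_bigr => m _; rewrite mcoeffD mcoeffZ scalerDl scalerA.
Qed.

HB.instance Definition _ :=
  GRing.isLinear.Build K R 'M[K]_r *:%R mx_eval mx_eval_is_linear.

Lemma mx_evalX m : mx_eval 'X_[m] = mx_monom m.
Proof. by rewrite /mx_eval msuppX big_seq1 mcoeffX eqxx scale1r. Qed.

Lemma mx_evalM p q : mx_eval (p * q) = mx_eval p *m mx_eval q.
Proof.
rewrite [mx_eval p]/mx_eval [mx_eval q]/mx_eval {1}[p]mpolyE {1}[q]mpolyE.
rewrite mulr_suml linear_sum mulmx_suml; apply: eq_bigr => m _.
rewrite mulr_sumr linear_sum mulmx_sumr; apply: eq_bigr => m' _.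
rewrite -scalerAl -scalerAr !linearZ /= -mpolyXD mx_evalX mx_monomD.
by rewrite -scalemxAl !scalerA [X in X *: _ = _]mulrC.
Qed.

End CommutingMatrices.

(** * Sets of monomials connected to 1 *)
Section Connected.
Variable N : nat.
Implicit Types B : seq 'X_{1..N}.

(** Induction on the degree: dividing by a variable inside B must end at 1. *)
Lemma connected_ind B (P : 'X_{1..N} -> Prop) : connected_to_1 B ->
  (0%MM \in B -> P 0%MM) ->
  (forall i m, m \in B -> (U_(i) + m)%MM \in B -> P m -> P (U_(i) + m)%MM) ->
  forall m, m \in B -> P m.
Proof.
move=> conB P0 PS m; have [n] := ubnP (mdeg m).
elim: n m => // n IHn m mn mB; have [m0|[i [m' m'B mE]]] := conB m mB.
  by rewrite m0 in mB *; apply: P0.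
rewrite mE in mB mn *; apply: PS => //; apply: IHn => //.
by move: mn; rewrite mdegD mdeg1.
Qed.

Lemma mem_mplus B m : m \in B -> m \in mplus B.
Proof. by move=> mB; rewrite mem_undup mem_cat mB. Qed.

Lemma mem_mplusU B i m : m \in B -> (U_(i) + m)%MM \in mplus B.
Proof.
move=> mB; rewrite mem_undup mem_cat; apply/orP; right.
by apply/allpairsP; exists (i, m); rewrite mem_enum.
Qed.

Lemma mplusP B m : m \in mplus B ->
  m \in B \/ exists i, exists2 m', m' \in B & m = (U_(i) + m')%MM.
Proof.
rewrite mem_undup mem_cat => /orP[|/allpairsP[[i m'] [_ m'B ->]]]; first by left.
by right; exists i, m'.
Qed.

End Connected.

(** * The flat extension *)
Section FlatExtension.
Variables (K : fieldType) (N r : nat) (B B' : r.-tuple 'X_{1..N}).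
Hypotheses (uniqB : uniq B) (uniqB' : uniq B').
Hypotheses (conB : connected_to_1 B) (conB' : connected_to_1 B').
Variable l : 'X_{1..N} -> K.

Let M := \matrix_(i, j) l (tnth B' i + tnth B j)%MM.
Let rowH s := \row_j l (s + tnth B j)%MM.
Let colH t := \col_i l (tnth B' i + t)%MM.

Hypothesis M_unit : M \in unitmx.
Hypothesis flat : forall s t, s \in mplus B' -> t \in mplus B ->
  l (s + t)%MM = (rowH s *m invmx M *m colH t) 0 0.

(** The Hankel matrix of B' and x_i B is also that of x_i B' and B, which is what
    ties the row side to the column side. X i is the only candidate for the
    matrix, in the basis B, of the multiplication by x_i in the quotient. *)
Let shiftH i := \matrix_(a, c) l (tnth B' a + (U_(i) + tnth B c))%MM.
Let X i := invmx M *m shiftH i.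

Let row_M a : row a M = rowH (tnth B' a).
Proof. by apply/rowP => j; rewrite !mxE. Qed.

Let col_M c : col c M = colH (tnth B c).
Proof. by apply/colP => j; rewrite !mxE. Qed.

Let row_shiftH i a : row a (shiftH i) = rowH (U_(i) + tnth B' a)%MM.
Proof. by apply/rowP => j; rewrite !mxE addmA [(_ + U_(i))%MM]addmC. Qed.

Let col_shiftH i c : col c (shiftH i) = colH (U_(i) + tnth B c)%MM.
Proof. by apply/colP => j; rewrite !mxE. Qed.

Let mulMX i : M *m X i = shiftH i.
Proof. by rewrite mulKVmx. Qed.

(** By flatness both sides are Hankel matrices, of x_i B' with x_j B and of
    x_j B' with x_i B, and their entries l (x_i x_j b' b) coincide. This is
    where both sets have to be enlarged by the variables. *)
Let shiftH_comm i j :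
  shiftH i *m invmx M *m shiftH j = shiftH j *m invmx M *m shiftH i.
Proof.
have entry i1 i2 : shiftH i1 *m invmx M *m shiftH i2 =
    \matrix_(a, c) l (U_(i1) + tnth B' a + (U_(i2) + tnth B c))%MM.
  apply/matrixP => a c; rewrite [RHS]mxE flat ?mem_mplusU ?mem_tnth //.
  rewrite -row_shiftH -col_shiftH -row_mul !mxE.
  by apply: eq_bigr => k _; rewrite [row _ _ _ _]mxE [col _ _ _ _]mxE.
rewrite !entry; apply/matrixP => a c; rewrite !mxE; congr (l _).
apply/mnmP => v; rewrite !mnmDE.
by rewrite addnACA [X in (X + _)%N = _]addnC addnACA.
Qed.

Let X_comm i j : X i *m X j = X j *m X i.
Proof.
have MXX a b : M *m (X a *m X b) = shiftH a *m invmx M *m shiftH b.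
  by rewrite mulmxA mulMX /X mulmxA.
by rewrite -[LHS](mulKmx M_unit) -[RHS](mulKmx M_unit) !MXX shiftH_comm.
Qed.

(** The coordinates of the monomial 1 in B and in B'. For r > 0 connectedness
    puts 1 in both sets; for r = 0 these are the empty vectors, and the
    statements below hold for them as well. *)
Let oneB : 'cV[K]_r := \col_j (tnth B j == 0%MM)%:R.
Let oneB' : 'rV[K]_r := \row_j (tnth B' j == 0%MM)%:R.

(** Since X i acts on the basis vector of b as the multiplication by x_i
    whenever x_i b is in B, building b from 1 by multiplications inside B sends
    the vector of 1 to the vector of b. *)
Let mx_monom_oneB m : m \in B ->
  forall j, tnth B j = m -> mx_monom X m *m oneB = delta_mx j 0.
Proof.
move: m; apply: (connected_ind conB) => [_ j jE|i m mB _ IHm j jE].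
  rewrite mx_monom0 mul1mx; apply/colP => a; rewrite !mxE -jE eqxx andbT.
  by rewrite (inj_eq (tuple_uniqP _ uniqB)).
have [c cE] := tnthP _ _ mB.
rewrite mx_monomD // -mulmxA (IHm c) // mx_monomU.
rewrite -[LHS](mulKmx M_unit) [M *m _]mulmxA mulMX -colE col_shiftH -cE -jE -col_M.
by rewrite colE mulKmx.
Qed.

(** The mirror statement for B': the relation M (X i) = shiftH i makes M (X i)
    M^-1 act on rows as the multiplication by x_i on B'. *)
Let mx_monom_oneB' m : m \in B' ->
  forall j, tnth B' j = m -> oneB' *m M *m mx_monom X m = row j M.
Proof.
move: m; apply: (connected_ind conB') => [_ j jE|i m mB _ IHm j jE].
  rewrite mx_monom0 mulmx1 rowE; congr (_ *m _); apply/rowP => a.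
  by rewrite !mxE -jE (inj_eq (tuple_uniqP _ uniqB')).
have [c cE] := tnthP _ _ mB.
rewrite addmC mx_monomD // mulmxA (IHm c) // mx_monomU -row_mul mulMX.
by rewrite row_shiftH -cE -jE -row_M.
Qed.

Let mulM_mx_monom_oneB t : t \in mplus B -> M *m (mx_monom X t *m oneB) = colH t.
Proof.
case/mplusP => [tB|[i [m mB ->]]].
  have [c cE] := tnthP _ _ tB.
  by rewrite (mx_monom_oneB tB (esym cE)) -colE col_M -cE.
have [c cE] := tnthP _ _ mB.
rewrite mx_monomD // -mulmxA (mx_monom_oneB mB (esym cE)) mx_monomU.
by rewrite mulmxA mulMX -colE col_shiftH -cE.
Qed.

Let oneB'_mx_monom s : s \in mplus B' -> oneB' *m M *m mx_monom X s = rowH s.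
Proof.
case/mplusP => [sB|[i [m mB ->]]].
  have [c cE] := tnthP _ _ sB.
  by rewrite (mx_monom_oneB' sB (esym cE)) row_M -cE.
have [c cE] := tnthP _ _ mB.
rewrite addmC mx_monomD // mulmxA (mx_monom_oneB' mB (esym cE)) mx_monomU.
by rewrite -row_mul mulMX row_shiftH -cE addmC.
Qed.

(** The form p |-> Lambda (p 1) read in coordinates: M represents the pairing
    (b', b) |-> Lambda (b' b), evaluated here at b' = 1 and p b = p. *)
Let Lt (p : {mpoly K[N]}) : K := (oneB' *m M *m mx_eval X p *m oneB) 0 0.

Let Lt_is_scalar : scalar Lt.
Proof.
by move=> a p q; rewrite /Lt linearP mulmxDr mulmxDl -scalemxAr -scalemxAl !mxE.
Qed.

HB.instance Definition _ :=
  GRing.isLinear.Build K {mpoly K[N]} K *%R Lt Lt_is_scalar.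

Let LtM p q :
  Lt (p * q) = ((oneB' *m M *m mx_eval X p) *m (mx_eval X q *m oneB)) 0 0.
Proof. by rewrite /Lt mx_evalM // !mulmxA. Qed.

(** The factor X^s goes to the left vector and X^t to the right one, which gives
    rowH s M^-1 colH t, the right-hand side of flatness. *)
Let Lt_ext s t : s \in mplus B' -> t \in mplus B -> Lt 'X_[s + t] = l (s + t)%MM.
Proof.
move=> sB tB; rewrite mpolyXD LtM !mx_evalX oneB'_mx_monom //.
by rewrite -[_ *m oneB](mulKmx M_unit) mulM_mx_monom_oneB // mulmxA flat.
Qed.

(** By commutation Lt (p q) vanishes for all q as soon as p(X) kills oneB.
    Conversely the left vectors obtained from q in B' are the rows of M, which
    separate vectors since M is invertible. *)
Let ker_oneB p : p \in hankel_ker Lt <-> mx_eval X p *m oneB = 0.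
Proof.
split=> [/hankel_kerP pL|p0]; last first.
  by apply/hankel_kerP => q /=; rewrite mulrC LtM p0 mulmx0 mxE.
apply: (can_inj (mulKmx M_unit)); rewrite mulmx0; apply/row_matrixP => a.
rewrite row_mul row0 -(mx_monom_oneB' (mem_tnth a B') erefl).
apply/matrixP => i j; rewrite !ord1 [RHS]mxE -mx_evalX.
by rewrite -LtM mulrC pL.
Qed.

Let ker_oneB' p : p \in hankel_ker Lt <-> oneB' *m M *m mx_eval X p = 0.
Proof.
split=> [/hankel_kerP pL|p0]; last first.
  by apply/hankel_kerP => q /=; rewrite LtM p0 mul0mx mxE.
apply/rowP => j; rewrite [RHS]mxE -[RHS](pL 'X_[tnth B j]) /= LtM mx_evalX.
by rewrite (mx_monom_oneB (mem_tnth j B) erefl) -colE [RHS]mxE.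
Qed.

Lemma flat_extension : exists L : {scalar {mpoly K[N]}},
  [/\ forall s t, s \in mplus B' -> t \in mplus B ->
        L 'X_[s + t] = l (s + t)%MM,
      lbasis (fun j => hankel_cls L 'X_[tnth B j]) setT &
      lbasis (fun j => hankel_cls L 'X_[tnth B' j]) setT].
Proof.
exists Lt; split; first exact: Lt_ext.
  apply: (hankel_basis_coord (T := mulmxr oneB \o mx_eval X)) => [p|j] /=.
    exact: ker_oneB.
  by rewrite mx_evalX (mx_monom_oneB (mem_tnth j B) erefl).
pose T : {linear 'rV[K]_r -> 'cV[K]_r} := trmx \o mulmxr (invmx M).
pose U : {linear _ -> 'rV[K]_r} := mulmx (oneB' *m M) \o mx_eval X.
apply: (hankel_basis_coord (T := T \o U)) => [p|j] /=.
  rewrite ker_oneB'; split=> [->|h]; first by rewrite mul0mx trmx0.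
  by rewrite -[LHS](mulmxKV M_unit) -[_ *m invmx M]trmxK h trmx0 mul0mx.
by rewrite mx_evalX (mx_monom_oneB' (mem_tnth j B') erefl) rowE mulmxK // trmx_delta.
Qed.

End FlatExtension.

(** * The extension criterion *)

Theorem theorem3p3 (K : closedFieldType) (charK : [pchar K] =i pred0)
  (k : nat) (n delta : 'I_k -> nat) (r : nat)
  (B B' : r.-tuple 'X_{1..\sum_(l < k) n l})
  (uniqB : uniq B) (uniqB' : uniq B')
  (degB : forall b, b \in B -> Rdelta K n delta 'X_[b])
  (degB' : forall b, b \in B' -> Rdelta K n delta 'X_[b])
  (conB : connected_to_1 B) (conB' : connected_to_1 B')
  (Lambda : {mpoly K[\sum_(l < k) n l]} -> K)
  (linLambda : linear_form_on
     (mspan K [set` mprod (mplus B') (mplus B)] `&` Rdelta K n delta) Lambda)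
  (h : 'X_{1..\sum_(l < k) n l} -> K)
  (Lambdah : {mpoly K[\sum_(l < k) n l]} -> K)
  (linLambdah : linear_form_on
     (mspan K [set` mprod (mplus B') (mplus B)]) Lambdah)
  (defLambdah : forall a, a \in mprod (mplus B') (mplus B) ->
     (Rdelta K n delta 'X_[a] -> Lambdah 'X_[a] = Lambda 'X_[a]) /\
     (~ Rdelta K n delta 'X_[a] -> Lambdah 'X_[a] = h a)) :
  (exists Lt : {scalar {mpoly K[\sum_(l < k) n l]}},
     [/\ forall p, mspan K [set` mprod (mplus B') (mplus B)] p ->
           Lt p = Lambdah p,
         has_rank (fun p => dual_fun (hankel_op Lt p)) r,
         lbasis (fun j => hankel_cls Lt 'X_[tnth B j]) setT &
         lbasis (fun j => hankel_cls Lt 'X_[tnth B' j]) setT])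
  <->
  (forall (f : 'I_r.+1 -> 'I_(size (mplus B')))
          (g : 'I_r.+1 -> 'I_(size (mplus B))),
     injective f -> injective g ->
     \det (mxsub f g
       (hankel_mx Lambdah (in_tuple (mplus B')) (in_tuple (mplus B)))) = 0) /\
  \det (hankel_mx Lambdah B' B) != 0.
Proof.
split=> [[Lt [Lt_ext _ B_basis B'_basis]]|[minors detM]].
  have Lt_mx p q (C' : p.-tuple 'X_{1.._}) (C : q.-tuple 'X_{1.._}) :
      {subset C' <= mplus B'} -> {subset C <= mplus B} ->
      hankel_mx Lambdah C' C = hankel_mx Lt C' C.
    move=> C'B C_B; apply/matrixP => i j; rewrite !mxE -mpolyXD.
    rewrite -Lt_ext //; apply: mspan_mpolyX; apply: allpairs_f.
      by apply: C'B; apply: mem_tnth.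
    by apply: C_B; apply: mem_tnth.
  rewrite !Lt_mx //; try by move=> m; apply: mem_mplus.
  split=> [f g _ _|]; first exact: (hankel_minor_eq0 B_basis).
  exact: (hankel_mx_det_neq0 B_basis).
pose l m := Lambdah 'X_[m].
set H := hankel_mx _ _ _ in minors.
have HE i j : H i j =
    l (tnth (in_tuple (mplus B')) i + tnth (in_tuple (mplus B)) j)%MM.
  by rewrite mxE -mpolyXD.
(* f and g locate B' and B among the rows and columns of H, so that the
   submatrix that they cut out is the invertible one to be bordered. *)
have /choice[f fE] a : exists i, tnth (in_tuple (mplus B')) i = tnth B' a.
  have /seq_tnthP[i iE] : tnth B' a \in mplus B' by rewrite mem_mplus ?mem_tnth.
  by exists i.
have /choice[g gE] c : exists j, tnth (in_tuple (mplus B)) j = tnth B c.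
  have /seq_tnthP[j jE] : tnth B c \in mplus B by rewrite mem_mplus ?mem_tnth.
  by exists j.
have MfgE : mxsub f g H = \matrix_(a, c) l (tnth B' a + tnth B c)%MM.
  by apply/matrixP => a c; rewrite mxE HE fE gE mxE.
have M_unit : \matrix_(a, c) l (tnth B' a + tnth B c)%MM \in unitmx.
  rewrite unitmxE unitfE; congr (\det _ != 0): detM.
  by apply/matrixP => a c; rewrite !mxE -mpolyXD.
have flat s t : s \in mplus B' -> t \in mplus B -> l (s + t)%MM =
    (\row_c l (s + tnth B c)%MM
     *m invmx (\matrix_(a, c) l (tnth B' a + tnth B c)%MM)
     *m \col_a l (tnth B' a + t)%MM) 0 0.
  move=> /seq_tnthP[i iE] /seq_tnthP[j jE].
  have -> : l (s + t)%MM = H i j by rewrite HE iE jE.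
  rewrite (bordered_minor_eq0 i j minors (f := f) (g := g)) MfgE //.
  congr ((_ *m _ *m _) 0 0).
    by apply/rowP => c; rewrite !mxE -mpolyXD gE iE.
  by apply/colP => a; rewrite !mxE -mpolyXD fE jE.
have [Lt [Lt_ext B_basis B'_basis]] :=
  flat_extension uniqB uniqB' conB conB' M_unit flat.
exists Lt; split=> //; last exact: hankel_basis_rank B_basis.
apply: eq_linear_form_on => // [a u v _ _|_ [m /allpairsP[[s t] [sB tB ->]] <-]].
  by rewrite linearP.
exact: Lt_ext.
Qed.
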